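(* Let $S\subseteq\mathbb{N}^2$ be a good semigroup and let $\eta\subseteq I_A(S)$ be such that $\operatorname{red}(\eta)=I_A(S)$ (i.e. $\eta\in\mathfrak{R}(S)$). Then $\eta$ is a system of representatives of $S$.
   Context: $\mathbb{N}=\{0,1,2,\dots\}$. A submonoid $S$ of $(\mathbb{N}^2,+)$ is a good semigroup if: (G1) $\boldsymbol{\alpha},\boldsymbol{\beta}\in S$ implies $\min(\boldsymbol{\alpha},\boldsymbol{\beta})=(\min\{\alpha_1,\beta_1\},\min\{\alpha_2,\beta_2\})\in S$; (G2) there is $\boldsymbol{\delta}\in\mathbb{N}^2$ with $\boldsymbol{\delta}+\mathbb{N}^2\subseteq S$; (G3) if $\boldsymbol{\alpha},\boldsymbol{\beta}\in S$, $\boldsymbol{\alpha}\ne\boldsymbol{\beta}$ and $\alpha_i=\beta_i$ for some $i$, then there is $\boldsymbol{\epsilon}\in S$ with $\epsilon_i>\alpha_i=\beta_i$ and $\epsilon_j\ge\min\{\alpha_j,\beta_j\}$ for $j\neq i$, with equality if $\alpha_j\ne\beta_j$. Good semigroups are always assumed local: if $\boldsymbol{\alpha}\in S$ has a zero coordinate, then $\boldsymbol{\alpha}=\boldsymbol{0}$. The multiplicity vector is $\boldsymbol{e}=(e_1,e_2)=\min(S\setminus\{\boldsymbol{0}\})$. Let $\overline{\mathbb{N}}=\mathbb{N}\cup\{\infty\}$ with $a<\infty$ for $a\in\mathbb{N}$ and $x+\infty=\infty$ for all $x$. Put $S_1^\infty=\{(a,\infty): a\in\mathbb{N},\ \exists\,\tilde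 y\ \forall y\ge\tilde y,\ (a,y)\in S\}$, $S_2^\infty=\{(\infty,b): b\in\mathbb{N},\ \exists\,\tilde x\ \forall x\ge\tilde x,\ (x,b)\in S\}$, $S^\infty=S_1^\infty\cup S_2^\infty\cup\{(\infty,\infty)\}$, $\Gamma_S=S\cup S^\infty$. Tropical operations on $\overline{\mathbb{N}}^2$: $\boldsymbol{\alpha}\oplus\boldsymbol{\beta}$ is the componentwise minimum and $\boldsymbol{\alpha}\odot\boldsymbol{\beta}=\boldsymbol{\alpha}+\boldsymbol{\beta}$. A good semigroup is identified with its semiring $\Gamma_S$, so ''$S$ contains $\eta$'' means $\eta\subseteq\Gamma_S$. $\langle\eta\rangle_\oplus$ denotes the semiring generated by $\eta\subseteq\overline{\mathbb{N}}^2$ (under $\oplus,\odot$). $\boldsymbol{\alpha}\in\Gamma_S\setminus\{\boldsymbol{0}\}$ is irreducible if $\boldsymbol{\alpha}=\boldsymbol{\beta}+\boldsymbol{\gamma}$ with $\boldsymbol{\beta},\boldsymbol{\gamma}\in\Gamma_S$ implies $\boldsymbol{\alpha}=\boldsymbol{\beta}$ or $\boldsymbol{\alpha}=\boldsymbol{\gamma}$. $\boldsymbol{\alpha}\in\Gamma_S$ is absolute if $\boldsymbol{\alpha}\in S^\infty$, or $\boldsymbol{\alpha}\in S\cap\mathbb{N}^2$ and no $\boldsymbol{\beta}\in S\cap\mathbb{N}^2$ satisfies ($\beta_1=\alpha_1,\beta_2>\alpha_2$) or ($\beta_2=\alpha_2,\beta_1>\alpha_1$). $I_A(S)$ is the (finite)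 set of irreducible absolute elements of $\Gamma_S$. $S_\eta$ is the family of good semigroups containing $\eta$ that are minimal for inclusion among good semigroups containing $\eta$. A set $\eta\subseteq I_A(S)$ is a system of representatives of $S$ if $S\in S_\eta$. Reducibility. For $\boldsymbol{\alpha}\in\mathbb{N}^2$ and $\{i,j\}=\{1,2\}$ let ${}_i\Delta(\boldsymbol{\alpha})=\{\boldsymbol{\beta}\in\mathbb{Z}^2:\beta_i=\alpha_i,\ \beta_j<\alpha_j\}$; also ${}_1\Delta((a,\infty))=\{\boldsymbol{\beta}\in\mathbb{Z}^2:\beta_1=a\}$, ${}_2\Delta((a,\infty))=\emptyset$, ${}_1\Delta((\infty,b))=\emptyset$, ${}_2\Delta((\infty,b))=\{\boldsymbol{\beta}\in\mathbb{Z}^2:\beta_2=b\}$. Let ${}_i\Delta^S(\boldsymbol{\alpha})=S\cap{}_i\Delta(\boldsymbol{\alpha})$ and ${}_i\Delta^\eta(\boldsymbol{\alpha})=\langle\eta\rangle_\oplus\cap{}_i\Delta(\boldsymbol{\alpha})$. For $*\in\{S,\eta\}$ let ${}_1\delta^{*}(\boldsymbol{\alpha})=\max\{y:(\alpha_1,y)\in{}_1\Delta^{*}(\boldsymbol{\alpha})\}$ if ${}_1\Delta^{*}(\boldsymbol{\alpha})\ne\emptyset$ and ${}_2\delta^{*}(\boldsymbol{\alpha})=\max\{x:(x,\alpha_2)\in{}_2\Delta^{*}(\boldsymbol{\alpha})\}$ if ${}_2\Delta^{*}(\boldsymbol{\alpha})\neq\emptyset$. Let $\eta\subseteq I_A(S)$.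 - Every $\boldsymbol{\alpha}\in\eta$ is reducible by $\eta$. - A finite $\boldsymbol{\alpha}=(\alpha_1,\alpha_2)\in I_A(S)\setminus\eta$ is reducible by $\eta$ if one of the following holds: (1) ${}_1\Delta^\eta(\boldsymbol{\alpha})\ne\emptyset$ and for every $y\in\{{}_1\delta^\eta(\boldsymbol{\alpha}),\dots,{}_1\delta^S(\boldsymbol{\alpha})\}$ with $(\alpha_1,y)\in S$ there is $(x,y)\in\langle\eta\rangle_\oplus$ with $x>\alpha_1$; (2) ${}_2\Delta^\eta(\boldsymbol{\alpha})\ne\emptyset$ and for every $x\in\{{}_2\delta^\eta(\boldsymbol{\alpha}),\dots,{}_2\delta^S(\boldsymbol{\alpha})\}$ with $(x,\alpha_2)\in S$ there is $(x,y)\in\langle\eta\rangle_\oplus$ with $y>\alpha_2$. - $\boldsymbol{\alpha}=(\alpha_1,\infty)\in I_A(S)\setminus\eta$ is reducible by $\eta$ if ${}_1\Delta^\eta(\boldsymbol{\alpha})\neq\emptyset$ and for every $y\in\{{}_1\delta^\eta(\boldsymbol{\alpha}),\dots,\max\{\tilde y,{}_1\delta^\eta(\boldsymbol{\alpha})\}+e_2-1\}$ with $(\alpha_1,y)\in S$ there is $(x,y)\in\langle\eta\rangle_\oplus$ with $x>\alpha_1$, where $\tilde y$ is the minimal integer with $(\alpha_1,y)\in S$ for all $y\ge\tilde y$. - $\boldsymbol{\alpha}=(\infty,\alpha_2)\in I_A(S)\setminus\eta$ is reducible by $\eta$ if ${}_2\Delta^\eta(\boldsymbol{\alpha})\neq\emptyset$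 and for every $x\in\{{}_2\delta^\eta(\boldsymbol{\alpha}),\dots,\max\{\tilde x,{}_2\delta^\eta(\boldsymbol{\alpha})\}+e_1-1\}$ with $(x,\alpha_2)\in S$ there is $(x,y)\in\langle\eta\rangle_\oplus$ with $y>\alpha_2$, where $\tilde x$ is the minimal integer with $(x,\alpha_2)\in S$ for all $x\ge\tilde x$. (In these conditions the witnesses $x$, resp. $y$, in $x>\alpha_1$, resp. $y>\alpha_2$, may be $\infty$.) Put $\langle\langle\eta\rangle\rangle=\{\boldsymbol{\alpha}\in I_A(S):\boldsymbol{\alpha}\text{ is reducible by }\eta\}\supseteq\eta$. Iterating $\eta\mapsto\langle\langle\eta\rangle\rangle$ until it stabilizes (which happens since $I_A(S)$ is finite) yields the set $\operatorname{red}(\eta)$. $\mathfrak{R}(S)=\{\eta\subseteq I_A(S):\operatorname{red}(\eta)=I_A(S)\}$. *)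

(* Defs.v *)
From mathcomp Require Import all_boot.
From mathcomp Require Import boolp classical_sets.

Set Implicit Arguments.
Unset Strict Implicit.
Unset Printing Implicit Defensive.

Local Open Scope classical_set_scope.
Local Open Scope nat_scope.

(* A coordinate index is a boolean [i]: [false] is the first coordinate,      *)
(* [true] the second, so that [~~ i] is the index j with {i, j} = {1, 2}.     *)
Definition coord (A : Type) (i : bool) (x : A * A) : A := if i then x.2 else x.1.

(* The pair with [a] in position [i] and [b] in position [~~ i].              *)
Definition pair_at (A : Type) (i : bool) (a b : A) : A * A :=
  if i then (b, a) else (a, b).

(* Maximum and minimum of a set of naturals; 0 when there is none.            *)
Definition set_max (A : set nat) : nat :=
  xget 0 [set m | A m /\ forall n, A n -> n <= m].
Definition set_min (A : set nat) : nat :=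
  xget 0 [set m | A m /\ forall n, A n -> m <= n].

Definition add2 (a b : nat * nat) : nat * nat := (a.1 + b.1, a.2 + b.2).
Definition min2 (a b : nat * nat) : nat * nat := (minn a.1 b.1, minn a.2 b.2).
Definition le2 (a b : nat * nat) : bool := (a.1 <= b.1) && (a.2 <= b.2).

Record good_semigroup (S : set (nat * nat)) : Prop := GoodSemigroup {
  good_zero : S (0, 0);
  good_add : forall a b, S a -> S b -> S (add2 a b);
  good_min : forall a b, S a -> S b -> S (min2 a b);
  good_conductor : exists d, forall a, S (add2 d a);
  good_exchange : forall a b (i : bool), S a -> S b -> a <> b ->
    coord i a = coord i b ->
    exists e, [/\ S e, coord i a < coord i e,
      minn (coord (~~ i) a) (coord (~~ i) b) <= coord (~~ i) e &
      coord (~~ i) a <> coord (~~ i) b ->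
      coord (~~ i) e = minn (coord (~~ i) a) (coord (~~ i) b)];
  good_local : forall a, S a -> (exists i, coord i a = 0) -> a = (0, 0) }.

(* The least element of S \ {0} for the componentwise order.                  *)
Definition multiplicity (S : set (nat * nat)) : nat * nat :=
  xget (0, 0) [set e | (S `\ (0, 0)) e /\ forall a, (S `\ (0, 0)) a -> le2 e a].

(* The naturals with infinity, [None] being infinity.                         *)
Definition nbar := option nat.

Definition nbar_add (x y : nbar) : nbar :=
  match x, y with Some a, Some b => Some (a + b) | _, _ => None end.

Definition nbar_min (x y : nbar) : nbar :=
  match x, y with
  | Some a, Some b => Some (minn a b)
  | None, _ => y
  | _, None => x
  end.

Definition nbar_lt (x y : nbar) : bool :=
  match x, y with
  | Some a, Some b => a < b
  | Some _, None => true
  | None, _ => false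
  end.

Definition ext2 := (nbar * nbar)%type.

Definition tmul (a b : ext2) : ext2 := (nbar_add a.1 b.1, nbar_add a.2 b.2).
Definition tadd (a b : ext2) : ext2 := (nbar_min a.1 b.1, nbar_min a.2 b.2).

Definition fin2 (a : nat * nat) : ext2 := (Some a.1, Some a.2).

(* (oo, oo) and (0, 0) are the neutral elements of [tadd] and [tmul].         *)
Definition subsemiring (X : set ext2) : Prop :=
  [/\ X (None, None), X (fin2 (0, 0)),
      forall a b, X a -> X b -> X (tadd a b) &
      forall a b, X a -> X b -> X (tmul a b)].

Definition semiring_gen (eta : set ext2) : set ext2 := smallest subsemiring eta.

Definition inf_part_at (i : bool) (S : set (nat * nat)) : set ext2 :=
  [set x | exists a : nat, x = pair_at i (Some a) None /\
     exists t, forall y, t <= y -> S (pair_at i a y)].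

Definition inf_part (S : set (nat * nat)) : set ext2 :=
  inf_part_at false S `|` inf_part_at true S `|` [set (None, None)].

Definition Gam (S : set (nat * nat)) : set ext2 := fin2 @` S `|` inf_part S.

Definition irreducible (S : set (nat * nat)) (x : ext2) : Prop :=
  (Gam S `\ fin2 (0, 0)) x /\
  forall b c, Gam S b -> Gam S c -> x = tmul b c -> x = b \/ x = c.

Definition absolute (S : set (nat * nat)) (x : ext2) : Prop :=
  inf_part S x \/
  exists a, [/\ S a, x = fin2 a &
    ~ exists2 b, S b & (b.1 = a.1 /\ a.2 < b.2) \/ (b.2 = a.2 /\ a.1 < b.1)].

Definition IA (S : set (nat * nat)) : set ext2 :=
  [set x | irreducible S x /\ absolute S x].

Definition minimal_good (eta : set ext2) : set (set (nat * nat)) :=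
  [set S | [/\ good_semigroup S, eta `<=` Gam S &
    forall T, good_semigroup T -> eta `<=` Gam T -> T `<=` S -> T = S]].

Definition system_of_representatives (S : set (nat * nat)) (eta : set ext2) :=
  eta `<=` IA S /\ minimal_good eta S.

(* Covers finite and infinite [x] at once: if coordinate [i] of [x] is        *)
(* infinite the set is empty, and if coordinate [~~ i] is infinite the second *)
(* condition always holds.                                                    *)
Definition Delta (i : bool) (x : ext2) : set (nat * nat) :=
  [set b | Some (coord i b) = coord i x /\
           nbar_lt (Some (coord (~~ i) b)) (coord (~~ i) x)].

Definition Delta_in (i : bool) (T : set (nat * nat)) (x : ext2) :
  set (nat * nat) := T `&` Delta i x.

Definition delta_in (i : bool) (T : set (nat * nat)) (x : ext2) : nat :=
  set_max (coord (~~ i) @` Delta_in i T x).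

Definition fin_gen (eta : set ext2) : set (nat * nat) :=
  fin2 @^-1` semiring_gen eta.

(* The points considered lie on the line where coordinate i equals a; the     *)
(* coordinate i of the witness b may be infinite.                             *)
Definition climbs (i : bool) (S : set (nat * nat)) (eta : set ext2)
    (a lo hi : nat) : Prop :=
  forall y, lo <= y <= hi -> S (pair_at i a y) ->
    exists2 b, semiring_gen eta b &
      coord (~~ i) b = Some y /\ nbar_lt (Some a) (coord i b).

Definition reducible_fin (S : set (nat * nat)) (eta : set ext2) (x : ext2) :=
  exists2 a, x = fin2 a & exists i,
    Delta_in i (fin_gen eta) x !=set0 /\
    climbs i S eta (coord i a) (delta_in i (fin_gen eta) x) (delta_in i S x).

Definition reducible_inf (S : set (nat * nat)) (eta : set ext2) (x : ext2) :=
  exists i (a : nat), [/\ x = pair_at i (Some a) None,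
    Delta_in i (fin_gen eta) x !=set0 &
    let d := delta_in i (fin_gen eta) x in
    let t := set_min [set t | forall y, t <= y -> S (pair_at i a y)] in
    climbs i S eta a d (maxn t d + coord (~~ i) (multiplicity S) - 1)].

Definition reducible_by (S : set (nat * nat)) (eta : set ext2) (x : ext2) :=
  eta x \/
  (IA S `\` eta) x /\ (reducible_fin S eta x \/ reducible_inf S eta x).

Definition red_step (S : set (nat * nat)) (eta : set ext2) : set ext2 :=
  [set x | IA S x /\ reducible_by S eta x].

(* The iterate of [red_step] at the first index where the sequence of         *)
(* iterates stabilizes.                                                       *)
Definition red (S : set (nat * nat)) (eta : set ext2) : set ext2 :=
  iter (set_min [set n | iter n.+1 (red_step S) eta = iter n (red_step S) eta])
    (red_step S) eta.

(* Main.v *)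
Require Import Defs.
From mathcomp Require Import all_boot.
From mathcomp Require Import boolp classical_sets.
From mathcomp Require Import zify.

Set Implicit Arguments.
Unset Strict Implicit.
Unset Printing Implicit Defensive.

Local Open Scope classical_set_scope.

(* Let T be a good semigroup with eta `<=` Gam T and T `<=` S.  An element of *)
(* I_A(S) reducible by eta lies in Gam T: otherwise take the highest point of *)
(* T below it on the line along which it is reducible; the reducibility       *)
(* condition provides a point of T on the same level further away, and (G3)   *)
(* then produces a higher point of T on the line.  For an infinite element    *)
(* the condition only covers a window of levels of length e_j, which is moved *)
(* upwards by an element of eta whose coordinate j is e_j.  Such an element   *)
(* exists, because one in I_A(S) is never reducible by elements with larger   *)
(* coordinate j.  Hence I_A(S) = red(eta) is contained in Gam T, and I_A(S)   *)
(* generates Gam S as a semiring.                                             *)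

(** Fix a good semigroup [T] inside [S] with [eta] in [Gam T]; minimality asks that [S] lie in [T].
    Two facts give this. Generation ([IA_generates]): a finite point is the minimum of the absolute
    elements topping its two lines, and absolute elements decompose into irreducible absolute ones,
    so a subsemiring containing [IA S], such as [Gam T] will be, contains [Gam S]. Reduction stays
    in [Gam T] ([red_step_Gam]): the highest point of [T] on the line below a reducible element
    would be lifted, through a generated witness at its level and (G3) for [T] ([good_climb]). For
    infinite elements, [reducible_inf_Gam] shifts a finite window of witnesses upwards by a vector
    of [eta] whose coordinate j equals e_j; [red_step_multiplicity] traces such a vector from [IA S]
    back to [eta]. *)

Section Coordinates.
Variables (A : Type) (i : bool).

Lemma coord_pair_at (a b : A) : coord i (pair_at i a b) = a.
Proof. by case: i. Qed.

Lemma coordN_pair_at (a b : A) : coord (~~ i) (pair_at i a b) = b.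
Proof. by case: i. Qed.

Lemma pair_at_coord (x : A * A) : pair_at i (coord i x) (coord (~~ i) x) = x.
Proof. by case: x; case: i. Qed.

Lemma pair_at_eq (x : A * A) a b :
  coord i x = a -> coord (~~ i) x = b -> x = pair_at i a b.
Proof. by move=> <- <-; rewrite pair_at_coord. Qed.

Lemma coord_eq (x y : A * A) :
  coord i x = coord i y -> coord (~~ i) x = coord (~~ i) y -> x = y.
Proof. by move=> /pair_at_eq e /e ->; rewrite pair_at_coord. Qed.

End Coordinates.

Lemma coord_fin2 i p : coord i (fin2 p) = Some (coord i p).
Proof. by case: i. Qed.

Lemma coord_tmul i x y :
  coord i (tmul x y) = nbar_add (coord i x) (coord i y).
Proof. by case: i. Qed.

Lemma fin2_inj : injective fin2.
Proof. by move=> [a b] [c d] [-> ->]. Qed.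

Lemma tmulC x y : tmul x y = tmul y x.
Proof.
case: x y => [[a|] [b|]] [[c|] [d|]]; rewrite /tmul //=.
all: by rewrite 1?addnC // 1?[b + d]addnC.
Qed.

Lemma tmul0l x : tmul (fin2 (0, 0)) x = x.
Proof. by case: x => [[a|] [b|]]. Qed.

Lemma max_or_unbounded (A : set nat) : A !=set0 ->
  (forall n, exists2 m, A m & n <= m) \/
  (exists2 m, A m & forall n, A n -> n <= m).
Proof.
move=> [a Aa]; have [?|/existsNP [n An]] :=
  pselect (forall n, exists2 m, A m & n <= m); [by left | right].
have bound m : `[< A m >] -> m <= n.
  by move/asboolP => Am; rewrite leqNgt; apply/negP => nm; apply: An; exists m => //; lia.
have exA : exists m, `[< A m >] by exists a; apply/asboolP.
case: (ex_maxnP exA bound) => m /asboolP Am mmax.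
by exists m => // k Ak; apply: mmax; apply/asboolP.
Qed.

Lemma set_max_le (A : set nat) m : (forall n, A n -> n <= m) -> set_max A <= m.
Proof.
by move=> Am; rewrite /set_max; case: xgetP => // k _ [/Am].
Qed.

Lemma set_max_ge (A : set nat) n b :
  (forall k, A k -> k <= b) -> A n -> n <= set_max A.
Proof.
move=> Ab An; rewrite /set_max; case: xgetP => [m _ [_]|none]; first exact.
have [unb|[m Am mmax]] := max_or_unbounded (ex_intro _ n An).
  by have [m /Ab] := unb b.+1; lia.
by case: (none m).
Qed.

Lemma set_min_in (A : set nat) n : A n -> A (set_min A).
Proof.
move=> An; rewrite /set_min; case: xgetP => [m _ [//]|none].
have exA : exists m, `[< A m >] by exists n; apply/asboolP.
case: (ex_minnP exA) => m /asboolP Am mmin; case: (none m); split=> // k Ak.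
by apply: mmin; apply/asboolP.
Qed.

(** * Good semigroups and the semiring [Gam S] *)

Section GoodSemigroup.
Variable (S : set (nat * nat)).
Hypothesis gS : good_semigroup S.

(** (G3) at the shared coordinate [~~ i] raises that coordinate; the other coordinates differ, so
    the new one is pinned to the smaller, [coord i p]. *)
Lemma good_climb i p q : S p -> S q ->
    coord (~~ i) p = coord (~~ i) q -> coord i p < coord i q ->
  exists2 r, S r & coord i r = coord i p /\ coord (~~ i) p < coord (~~ i) r.
Proof.
move=> Sp Sq eq_pq lt_pq.
have ne_pq : p <> q by move=> e; rewrite e ltnn in lt_pq.
have [r [Sr lt_r _]] := good_exchange gS Sp Sq ne_pq eq_pq.
rewrite negbK => eq_r; exists r => //; split=> //.
by rewrite eq_r; lia.
Qed.

Lemma Gam_fin p : Gam S (fin2 p) <-> S p.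
Proof.
split=> [[[q Sq /fin2_inj <-] //|[[|]|]]|Sp]; last by left; exists p.
- by case=> a [].
- by case=> a [].
- by [].
Qed.

(** Infinity is read as all sufficiently large values, with one threshold for both coordinates; this
    treats all shapes of [x] uniformly. *)
Lemma GamP x : Gam S x <->
  exists N, forall n m, N <= n -> N <= m -> S (odflt n x.1, odflt m x.2).
Proof.
split.
  case=> [[[a b] Sp <-]|]; first by exists 0.
  case=> [[[a [-> [t St]]]|[a [-> [t St]]]]|->].
  - by exists t => n m _ /St.
  - by exists t => n m /St.
  - have [[d1 d2] Sd] := good_conductor gS.
    exists (d1 + d2) => n m ln lm /=.
    have := Sd (n - d1, m - d2); rewrite /add2 /=.
    by rewrite !subnKC //; lia.
case: x => [[a|] [b|]] [N SN].
- by left; exists (a, b) => //; apply: (SN N N).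
- right; left; left; exists a; split=> //; exists N => y Ny.
  exact: (SN N y).
- right; left; right; exists b; split=> //; exists N => y Ny.
  exact: (SN y N).
- by right; right.
Qed.

(** By (G1), the minimum of a high point of the line and a conductor point at height [y] is exactly
    the point of the line at height [y]. *)
Lemma Gam_line i a :
  (forall n, exists2 y, S (pair_at i a y) & n <= y) ->
  Gam S (pair_at i (Some a) None).
Proof.
move=> unb; have [d Sd] := good_conductor gS.
suff line : inf_part_at i S (pair_at i (Some a) None).
  by right; left; case: (i) line; [right | left].
exists a; split=> //; exists (coord (~~ i) d) => y dy.
have [z Sz yz] := unb y.
have := good_min gS Sz (Sd (pair_at i a (y - coord (~~ i) d))).
by case: (i) dy => /= dy; rewrite /min2 /add2 /=; congr S; congr pair; lia.
Qed.

Lemma Gam_line_inv i a : Gam S (pair_at i (Some a) None) ->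
  exists t, forall y, t <= y -> S (pair_at i a y).
Proof.
by move=> /GamP [N SN]; exists N => y Ny; case: (i) SN => SN; exact: (SN y y).
Qed.

Lemma Gam_point i x y a : Gam S x -> coord (~~ i) x = Some y ->
    nbar_lt (Some a) (coord i x) ->
  exists2 p, S p & coord (~~ i) p = y /\ a < coord i p.
Proof.
move=> /GamP [N SN] xy ax.
(* The value [N + a.+1] passes the threshold and exceeds [a] in case coordinate [i] is infinite. *)
exists (odflt (N + a.+1) x.1, odflt (N + a.+1) x.2); first by apply: SN; lia.
case: x xy ax {SN} => [x1 x2]; case: (i) => /= -> /=.
  by case: x2 => //= *; split=> //; lia.
by case: x1 => //= *; split=> //; lia.
Qed.

Lemma subsemiring_Gam : subsemiring (Gam S).
Proof.
(* A large value of an infinite sum splits so that each infinite summand receives a value past its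
   own threshold. *)
have coord_add (x y : nbar) N N' : exists M, forall n, M <= n ->
    exists k l, [/\ N <= k, N' <= l &
      odflt n (nbar_add x y) = odflt k x + odflt l y].
  case: x y => [a|] [b|] /=.
  - by exists 0 => n _; exists N, N'.
  - by exists (a + N') => n ln; exists N, (n - a); split; lia.
  - by exists (b + N) => n ln; exists (n - b), N'; split; lia.
  - by exists (N + N') => n ln; exists N, (n - N); split; lia.
have coord_min (x y : nbar) N : exists M, forall n, M <= n ->
    N <= n /\ odflt n (nbar_min x y) = minn (odflt n x) (odflt n y).
  case: x y => [a|] [b|] /=.
  - by exists N => n ln.
  - by exists (a + N) => n ln; split; lia.
  - by exists (b + N) => n ln; split; lia.
  - by exists N => n ln; split; lia.
split.
- by right; right.
- by apply/Gam_fin; apply: good_zero gS.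
- move=> x y /GamP [N SN] /GamP [N' SN'].
  have [M1 H1] := coord_min x.1 y.1 (N + N').
  have [M2 H2] := coord_min x.2 y.2 (N + N').
  apply/GamP; exists (M1 + M2) => n m ln lm /=.
  have [? ->] : _ /\ _ := H1 n ltac:(lia).
  have [? ->] : _ /\ _ := H2 m ltac:(lia).
  by apply: (good_min gS (SN n m _ _) (SN' n m _ _)); lia.
- move=> x y /GamP [N SN] /GamP [N' SN'].
  have [M1 H1] := coord_add x.1 y.1 N N'.
  have [M2 H2] := coord_add x.2 y.2 N N'.
  apply/GamP; exists (M1 + M2) => n m ln lm /=.
  have [k1 [l1 [? ? ->]]] := H1 n ltac:(lia).
  have [k2 [l2 [? ? ->]]] := H2 m ltac:(lia).
  by apply: (good_add gS (SN k1 k2 _ _) (SN' l1 l2 _ _)); lia.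
Qed.

(** * The multiplicity vector *)

Lemma good_pos p i : S p -> p <> (0, 0) -> 0 < coord i p.
Proof.
move=> Sp p0; rewrite lt0n; apply/eqP => pi0.
by apply: p0; apply: (good_local gS Sp); exists i.
Qed.

Lemma multiplicityP : (S `\ (0, 0)) (multiplicity S) /\
  forall a, (S `\ (0, 0)) a -> le2 (multiplicity S) a.
Proof.
rewrite /multiplicity; case: xgetP => [e _ //|none]; exfalso.
have [d Sd] := good_conductor gS.
have coord_least i : exists2 p, (S `\ (0, 0)) p &
    forall q, (S `\ (0, 0)) q -> coord i p <= coord i q.
  pose A := [set n | exists2 p, (S `\ (0, 0)) p & coord i p = n].
  have exA : exists n, `[< A n >].
    exists (coord i (add2 d (1, 1))); apply/asboolP; exists (add2 d (1, 1)) => //.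
    by split=> // -[]; lia.
  case: (ex_minnP exA) => n /asboolP [p Sp <-] nmin; exists p => // q Sq.
  by apply: nmin; apply/asboolP; exists q.
have [p [Sp p0] pmin] := coord_least false.
have [q [Sq q0] qmin] := coord_least true.
have pos1 : forall r, (S `\ (0, 0)) r -> 0 < r.1 /\ 0 < r.2.
  by move=> r [Sr r0]; split; [exact: (@good_pos r false)|exact: (@good_pos r true)].
(* (G1) merges the two coordinatewise minimizers; locality makes their coordinates positive, so the
   merged point is nonzero. *)
apply: (none (min2 p q)); split.
  split; first exact: good_min gS _ _ Sp Sq.
  by have := pos1 p (conj Sp p0); have := pos1 q (conj Sq q0); move=> ? ? []; lia.
move=> r Sr; apply/andP => /=.
by have := pmin r Sr; have := qmin r Sr => /=; lia.
Qed.

Lemma multiplicity_pos i : 0 < coord i (multiplicity S).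
Proof. by have [[Se e0] _] := multiplicityP; apply: good_pos. Qed.

Lemma multiplicity_le i x k : Gam S x -> x <> fin2 (0, 0) ->
  coord i x = Some k -> coord i (multiplicity S) <= k.
Proof.
move=> /GamP [N SN] x0 xk.
(* With [N.+1] an infinite coordinate takes a positive value, so the sampled point is nonzero. *)
have Sp := SN N.+1 N.+1 (leqnSn _) (leqnSn _).
have [_ /(_ _ (conj Sp _))] := multiplicityP.
case: x xk x0 {SN Sp} => x1 x2 /= xk x0 /(_ _)/andP [].
  by case: x1 x2 xk x0 => [a|] [b|] //= _ x0 [] // ? ?; subst; apply: x0.
by case: (i) xk => /= -> /=.
Qed.

(** * Absolute elements and the generation of [Gam S] *)

Lemma absolute_finP p : S p -> absolute S (fin2 p) <->
  forall i q, S q -> coord i q = coord i p -> coord (~~ i) q <= coord (~~ i) p.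
Proof.
move=> Sp; split=> [[[[[a []]|[a []]]|]|[q [_ /fin2_inj <- noq]]] //|pmax].
  move=> i r Sr eqr; rewrite leqNgt; apply/negP => ltr; apply: noq.
  by exists r => //; case: (i) eqr ltr => /= ? ?; [right|left].
right; exists p; split=> // -[q Sq [[eq1 lt2]|[eq2 lt1]]].
- by have := pmax false q Sq eq1 => /=; lia.
- by have := pmax true q Sq eq2 => /=; lia.
Qed.

Lemma absolute_line i a :
  Gam S (pair_at i (Some a) None) -> absolute S (pair_at i (Some a) None).
Proof. by left; case: H => // -[p _]; case: (i). Qed.

(** The top of a bounded line is also maximal on the crossing line: a point further along that line
    would raise the top by [good_climb]. An unbounded line ends in an infinite element. *)
Lemma absolute_top i p : S p -> exists x,
  [/\ Gam S x, absolute S x, coord i x = Some (coord i p) &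
      ~~ nbar_lt (coord (~~ i) x) (Some (coord (~~ i) p))].
Proof.
move=> Sp.
pose A := [set y | S (pair_at i (coord i p) y)].
have Ap : A (coord (~~ i) p) by rewrite /A /= pair_at_coord.
have [unb|[y Ay ymax]] := max_or_unbounded (ex_intro _ _ Ap).
  have G := Gam_line unb; exists (pair_at i (Some (coord i p)) None).
  by rewrite coord_pair_at coordN_pair_at; split=> //; exact: absolute_line.
exists (fin2 (pair_at i (coord i p) y)).
rewrite !coord_fin2 coord_pair_at coordN_pair_at /= -leqNgt.
split=> //; [exact/Gam_fin| |exact: ymax].
apply/absolute_finP => // j q Sq.
have [->|] := eqVneq j i; rewrite ?coord_pair_at ?coordN_pair_at.
  move=> eqj; apply: ymax; rewrite /A /=.
  by rewrite -(pair_at_eq eqj erefl).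
have [-> _|/eqP ne1 /eqP ne2] := eqVneq j (~~ i); last first.
  by case: (i) (j) ne1 ne2 => [] [].
rewrite negbK coord_pair_at coordN_pair_at => eqj.
rewrite leqNgt; apply/negP => lt_q.
have [||r Sr [eqr]] := @good_climb i _ q Ay Sq.
- by rewrite coordN_pair_at.
- by rewrite coord_pair_at.
rewrite coord_pair_at in eqr; rewrite coordN_pair_at.
have : A (coord (~~ i) r) by rewrite /A /= -(pair_at_eq eqr erefl).
by move/ymax; lia.
Qed.

Lemma IA_generates X : subsemiring X -> IA S `<=` X -> Gam S `<=` X.
Proof.
move=> [Xoo X0 Xadd Xmul] IAX.
have decompose x : Gam S x -> absolute S x -> X x \/ exists b c,
    [/\ Gam S b, Gam S c, x = tmul b c, x <> b & x <> c].
  move=> Gx abs_x; have [->|x0] := pselect (x = fin2 (0, 0)); first by left.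
  have [Xx|nXx] := pselect (X x); [by left|right].
  apply: contrapT => no; apply: nXx; apply: IAX; split=> //; split=> //.
  move=> b c Gb Gc xbc; apply: contrapT => /not_orP [xb xc].
  by apply: no; exists b, c.
have ne0 x b c : x = tmul b c -> x <> c -> b <> fin2 (0, 0).
  by move=> -> h b0; apply: h; rewrite b0 tmul0l.
(* Induction on the first coordinate: the summands are nonzero, hence smaller by locality, and
   absolute, since raising one along a line would raise the sum. *)
have finX p : S p -> absolute S (fin2 p) -> X (fin2 p).
  have [n] := ubnP p.1; elim: n p => // n IHn p lt_pn Sp abs_p.
  have [//|[b [c [Gb Gc eq_p pb pc]]]] := decompose _ (iffRL (Gam_fin p) Sp) abs_p.
  have b0 := ne0 _ _ _ eq_p pc.
  have c0 : c <> fin2 (0, 0) by apply: (ne0 (fin2 p) _ b) => //; rewrite tmulC.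
  case: b c Gb Gc eq_p {pb pc} b0 c0 =>
    [[b1|] [b2|]] [[c1|] [c2|]] // Gb Gc [p1 p2] b0 c0.
  have Sb : S (b1, b2) by apply/Gam_fin.
  have Sc : S (c1, c2) by apply/Gam_fin.
  have bpos : 0 < b1 by apply: (good_pos false Sb) => -[? ?]; apply: b0; subst.
  have cpos : 0 < c1 by apply: (good_pos false Sc) => -[? ?]; apply: c0; subst.
  have eq_p : fin2 p = tmul (fin2 (b1, b2)) (fin2 (c1, c2)) by rewrite /fin2 p1 p2.
  have pmax := iffLR (absolute_finP Sp) abs_p.
  rewrite eq_p; apply: Xmul; apply: IHn => //=; try lia; apply/absolute_finP => //.
  - move=> i q Sq eq_q; have := pmax i _ (good_add gS Sq Sc).
    by case: (i) eq_q; rewrite /= ?p1 ?p2 => -> /(_ erefl); lia.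
  - move=> i q Sq eq_q; have := pmax i _ (good_add gS Sb Sq).
    by case: (i) eq_q; rewrite /= ?p1 ?p2 => -> /(_ erefl); lia.
(* Induction on the finite coordinate. Some summand [b] is infinite in direction [~~ i], so the
   other one matters only through its coordinate [i] and may be exchanged for an absolute [y]
   agreeing there. *)
have lineX i a : Gam S (pair_at i (Some a) None) -> X (pair_at i (Some a) None).
  have [n] := ubnP a; elim: n a => // n IHn a lt_an Ga.
  have [//|[b [c [Gb Gc]]]] := decompose _ Ga (absolute_line Ga).
  wlog b_oo : b c Gb Gc / coord (~~ i) b = None.
    move=> wl eq_a ab ac.
    have := congr1 (coord (~~ i)) eq_a; rewrite coordN_pair_at coord_tmul.
    case bE : (coord (~~ i) b) => [b'|]; last by move=> _; apply: (wl b c).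
    case cE : (coord (~~ i) c) => [c'|] // _.
    by apply: (wl c b) => //; rewrite tmulC.
  move=> eq_a ab ac; have b0 := ne0 _ _ _ eq_a ac.
  have := congr1 (coord i) eq_a; rewrite coord_pair_at coord_tmul.
  case bE : (coord i b) => [b'|] //; case cE : (coord i c) => [c'|] // [aE].
  have eq_b := pair_at_eq bE b_oo.
  have lt_b : b' < a.
    rewrite ltn_neqAle aE leq_addr andbT; apply/eqP => e.
    by apply: ab; rewrite eq_b aE -e.
  have b_pos : 0 < b'.
    exact: leq_trans (multiplicity_pos i) (multiplicity_le Gb b0 bE).
  have [y Xy yE] : exists2 y, X y & coord i y = Some c'.
    have c'X : Gam S (pair_at i (Some c') None) ->
        exists2 y, X y & coord i y = Some c'.
      move=> Gc'; exists (pair_at i (Some c') None); last exact: coord_pair_at.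
      by apply: IHn => //; lia.
    case cE' : (coord (~~ i) c) => [c''|]; last first.
      by apply: c'X; rewrite -(pair_at_eq cE cE').
    have eq_c : c = fin2 (pair_at i c' c'').
      by rewrite (pair_at_eq cE cE'); case: (i).
    have Sc : S (pair_at i c' c'') by apply/Gam_fin; rewrite -eq_c.
    have [y [Gy abs_y yE _]] := absolute_top i Sc.
    rewrite coord_pair_at in yE.
    case yE' : (coord (~~ i) y) => [y''|]; last first.
      by apply: c'X; rewrite -(pair_at_eq yE yE').
    have eq_y : y = fin2 (pair_at i c' y'').
      by rewrite (pair_at_eq yE yE'); case: (i).
    exists y => //; rewrite eq_y; rewrite eq_y in Gy abs_y.
    by apply: finX => //; apply/Gam_fin.
  have -> : pair_at i (Some a) None = tmul b y.
    apply: (@coord_eq _ i); rewrite coord_tmul ?coord_pair_at ?coordN_pair_at.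
      by rewrite bE yE aE.
    by rewrite b_oo.
  by apply: Xmul => //; rewrite eq_b; apply: IHn; rewrite -?eq_b //; lia.
have absX x : Gam S x -> absolute S x -> X x.
  case: x => [[a|] [b|]] //.
  - by move=> /(Gam_fin (a, b)); apply: finX.
  - by move=> /(lineX false a).
  - by move=> /(lineX true b).
move=> x Gx; case: x Gx => [[a|] [b|]] Gx //.
- have Sab : S (a, b) by apply/Gam_fin.
  (* The tops of the two lines through (a, b) have (a, b) as their minimum. *)
  have [y [Gy abs_y]] := absolute_top false Sab.
  have [z [Gz abs_z]] := absolute_top true Sab.
  have := Xadd _ _ (absX _ Gy abs_y) (absX _ Gz abs_z).
  case: y z {Gy abs_y Gz abs_z} => [y1 y2] [z1 z2] /= Xyz zE lez yE ley.
  move: Xyz; rewrite /tadd /= zE yE; congr X.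
  case: y2 z1 lez ley {zE yE} => [y2|] [z1|] //= *;
    by congr (Some _, Some _); lia.
- exact: (lineX false a).
- exact: (lineX true b).
Qed.

(** * Elements attaining a coordinate of the multiplicity vector *)

Lemma IA_multiplicity i :
  exists2 x, IA S x & coord i x = Some (coord i (multiplicity S)).
Proof.
have [[Se e0] _] := multiplicityP.
have [x [Gx abs_x xE _]] := absolute_top i Se.
have e_pos := multiplicity_pos i.
exists x => //; split=> //; split.
  by split=> // x0; move: e_pos xE; rewrite x0; case: (i) => /= pos [eq0]; lia.
move=> b c Gb Gc eq_x.
have [b0|b0] := pselect (b = fin2 (0, 0)); first by right; rewrite eq_x b0 tmul0l.
have [c0|c0] := pselect (c = fin2 (0, 0)); first by left; rewrite eq_x c0 tmulC tmul0l.
move: xE; rewrite eq_x coord_tmul.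
case bE : (coord i b) => [b'|] //; case cE : (coord i c) => [c'|] //= [].
(* Two nonzero summands would at least double this positive coordinate. *)
by have := multiplicity_le Gb b0 bE; have := multiplicity_le Gc c0 cE; lia.
Qed.

(** Being zero or having coordinate [i] above [e] survives minima and sums, so it passes from the
    generators to the semiring. *)
Lemma semiring_gen_coord (eta : set ext2) i e b :
    (forall x, eta x -> x <> fin2 (0, 0) -> nbar_lt (Some e) (coord i x)) ->
  fin_gen eta b -> b <> (0, 0) -> e < coord i b.
Proof.
move=> eta_gt gen_b b0.
pose X := [set x | x = fin2 (0, 0) \/ nbar_lt (Some e) (coord i x)].
have [/fin2_inj //|] : X (fin2 b); last by rewrite coord_fin2.
apply: gen_b; split; last first.
  by move=> x ex; have [->|x0] := pselect (x = fin2 (0, 0)); [left|right; apply: eta_gt].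
split.
- by right; case: (i).
- by left.
- move=> x y [->|xe] [->|ye]; [by left| | |].
  + by left; case: y ye => [[y1|] [y2|]] _; rewrite /tadd /fin2 /= ?min0n.
  + by left; case: x xe => [[y1|] [y2|]] _; rewrite /tadd /fin2 /= ?minn0.
  + right; case: x y xe ye => [x1 x2] [y1 y2]; case: (i) => /=.
      by case: x2 y2 => [x2|] [y2|] //=; lia.
    by case: x1 y1 => [x1|] [y1|] //=; lia.
- move=> x y [->|xe]; first by rewrite tmul0l.
  move=> [->|ye]; first by rewrite tmulC tmul0l; right.
  right; rewrite coord_tmul.
  by case: (coord i x) (coord i y) xe ye => [?|] [?|] //=; lia.
Qed.

Lemma semiring_gen_Gam eta : eta `<=` Gam S -> semiring_gen eta `<=` Gam S.
Proof. by move=> etaS x; apply; split=> //; apply: subsemiring_Gam. Qed.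

(** A reducible [x] has a generated point [b] below it on one of its lines. On the line fixing
    coordinate [i], [b] attains the multiplicity, which generators larger there cannot produce. On
    the other line [b] would be zero, and locality would make [x] zero. *)
Lemma red_step_multiplicity i eta x : eta `<=` Gam S -> red_step S eta x ->
    coord i x = Some (coord i (multiplicity S)) ->
  exists2 y, eta y & coord i y = Some (coord i (multiplicity S)).
Proof.
move=> etaS [_ [|[[[[[Gx x0] _] _] _] red_x]]] xE; first by exists x.
have e_pos := multiplicity_pos i.
have [b gen_b bE] : exists2 b, fin_gen eta b & coord i b = coord i (multiplicity S).
  case: red_x => [[a eq_x [j [[b [gen_b [b_eq b_lt]]] _]]]|]; last first.
    move=> [j [a [eq_x [b [gen_b [b_eq _]]] _]]]; exists b => //.
    suff ij : i = j by move: b_eq; rewrite -ij xE => -[].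
    by move: xE; rewrite eq_x; case: (i) (j) => [] [].
  have [ij|ij] := eqVneq i j.
    by exists b => //; move: b_eq; rewrite -ij xE => -[].
  have ji : ~~ j = i by case: (i) (j) ij => [] [].
  have Sb : S b by apply/Gam_fin; apply: semiring_gen_Gam gen_b.
  rewrite ji xE /= in b_lt.
  have b0 : b = (0, 0).
    apply: contrapT => b0; move: b_lt; rewrite ltnNge => /negP; apply.
    by apply: (@multiplicity_le i (fin2 b)); rewrite ?coord_fin2 //;
      [exact/Gam_fin|move/fin2_inj].
  case: x0; rewrite eq_x; congr fin2; apply: (good_local gS).
    by apply/Gam_fin; rewrite -eq_x.
  by exists j; move: b_eq; rewrite eq_x coord_fin2 b0 => -[<-]; case: (j).
apply: contrapT => none; suff : coord i (multiplicity S) < coord i b by rewrite bE ltnn.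
apply: (@semiring_gen_coord eta) gen_b _.
- move=> y ey y0; case yE : (coord i y) => [k|] //=.
  have := multiplicity_le (etaS _ ey) y0 yE; rewrite leq_eqVlt => /orP [/eqP e|//].
  by case: none; exists y => //; rewrite yE e.
- by move=> b0; move: bE e_pos; rewrite b0; case: (i) => /= <-.
Qed.

End GoodSemigroup.

(** * Reducible elements stay in a smaller good semigroup *)

Section Minimality.
Variables (S T : set (nat * nat)).
Hypotheses (gS : good_semigroup S) (gT : good_semigroup T) (TS : T `<=` S).

(** The highest point of [T] below [a] on the line is lifted within [T]. Absoluteness in [S] keeps
    the lifted point from passing [a], and the choice of the highest point keeps it from stopping
    short, so it is [a]. *)
Lemma reducible_fin_Gam eta x : eta `<=` Gam T -> absolute S x -> Gam S x ->
  reducible_fin S eta x -> Gam T x.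
Proof.
move=> etaT abs_x Gx [a eq_x [i [[b [gen_b [b_eq b_lt]]] climb]]].
have genT := semiring_gen_Gam gT etaT.
have Sa : S a by apply/Gam_fin; rewrite -eq_x.
rewrite {}eq_x in abs_x Gx b_eq b_lt climb *.
have amax := iffLR (absolute_finP Sa) abs_x.
apply/Gam_fin.
rewrite !coord_fin2 /= in b_eq b_lt; case: b_eq => b_eq.
pose A := [set y | T (pair_at i (coord i a) y) /\ y < coord (~~ i) a].
have Ab : A (coord (~~ i) b).
  split=> //; rewrite -b_eq pair_at_coord; apply/Gam_fin; exact: genT.
have [unb|[y [Ty lt_ya] ymax]] := max_or_unbounded (ex_intro _ _ Ab).
  by have [y [_ ?]] := unb (coord (~~ i) a); lia.
have [] := climb y _ (TS Ty).
  (* The level is in range since generated points lie in [T] and [T] lies in [S]. *)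
  apply/andP; split.
    apply: set_max_le => _ [c [gen_c [c_eq c_lt]] <-]; apply: ymax.
    rewrite !coord_fin2 /= in c_eq c_lt; case: c_eq => c_eq; split=> //.
    by rewrite -c_eq pair_at_coord; apply/Gam_fin; exact: genT.
  apply: (@set_max_ge _ _ (coord (~~ i) a)).
    by move=> _ [c [_ [_ c_lt]] <-]; rewrite coord_fin2 /= in c_lt; lia.
  exists (pair_at i (coord i a) y); last exact: coordN_pair_at.
  split; first exact: TS.
  by split; rewrite ?coord_fin2 ?coord_pair_at ?coordN_pair_at.
move=> z /genT Gz [zy az]; have [q Tq [qy aq]] := Gam_point gT Gz zy az.
have [||r Tr [r_eq r_gt]] := @good_climb T gT i _ q Ty Tq.
- by rewrite coordN_pair_at qy.
- by rewrite coord_pair_at.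
rewrite coord_pair_at in r_eq; rewrite coordN_pair_at in r_gt.
suff -> : a = r by [].
apply: (@coord_eq _ i) => //.
have := amax i r (TS Tr) r_eq; rewrite leq_eqVlt => /orP [/eqP //|lt_r].
have /ymax : A (coord (~~ i) r) by split; rewrite // -(pair_at_eq r_eq erefl).
by lia.
Qed.

Lemma Gam_iter_tmul b c k : Gam T b -> Gam T c -> Gam T (iter k (tmul c) b).
Proof.
have [_ _ _ mulT] := subsemiring_Gam gT.
by move=> Gb Gc; elim: k => //= k IHk; apply: mulT.
Qed.

(** A top of the line in [T] would be lifted by a witness at its level, so the line is unbounded in
    [T] and [Gam_line] applies. *)
Lemma reducible_inf_Gam eta x : eta `<=` Gam T ->
    (forall i, exists2 c, eta c & coord i c = Some (coord i (multiplicity S))) ->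
  Gam S x -> reducible_inf S eta x -> Gam T x.
Proof.
move=> etaT eta_e Gx [i [a [eq_x [b [gen_b [b_eq _]]] /= climb]]].
have genT := semiring_gen_Gam gT etaT.
set t := set_min _ in climb; set d := delta_in _ _ _ in climb.
have St y : t <= y -> S (pair_at i a y).
  rewrite eq_x in Gx; have [t0 St0] := Gam_line_inv gS Gx.
  exact: (@set_min_in [set t | forall y, t <= y -> S (pair_at i a y)] t0).
rewrite eq_x in b_eq d climb *; rewrite coord_pair_at in b_eq.
case: b_eq => b_eq.
have e_pos := multiplicity_pos gS (~~ i).
set e := coord (~~ i) (multiplicity S) in climb e_pos.
pose A := [set y | T (pair_at i a y)].
have Ab c : fin_gen eta c -> coord i c = a -> A (coord (~~ i) c).
  rewrite /A /= => gen_c <-; rewrite pair_at_coord; apply/Gam_fin; exact: genT.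
have [/(Gam_line gT) //|[y Ty ymax]] := max_or_unbounded (ex_intro _ _ (Ab b gen_b b_eq)).
have le_dy : d <= y.
  apply: set_max_le => _ [c [gen_c [c_eq _]] <-]; apply/ymax/Ab => //.
  by move: c_eq; rewrite coord_pair_at => -[].
have [q Tq [qy aq]] : exists2 q, T q & coord (~~ i) q = y /\ a < coord i q.
  have [le_y|gt_y] := leqP y (maxn t d + e - 1).
    have [|z /genT Gz [zy az]] := climb y _ (TS Ty); first by rewrite le_dy.
    exact: Gam_point Gz zy az.
  (* Adding [c] raises the level by exactly [e]: the witness at the representative of [y] modulo [e]
     in the window starting at [maxn t d] is carried to level [y]. *)
  have [c ec cE] := eta_e (~~ i); rewrite -/e in cE.
  pose k := (y - maxn t d) %/ e.
  have yE : y = k * e + (maxn t d + (y - maxn t d) %% e).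
    by rewrite addnCA -divn_eq; lia.
  have := ltn_pmod (y - maxn t d) e_pos.
  set w := _ %% e in yE *; move=> lt_we.
  have [||z /genT Gz [zw az]] := climb (maxn t d + w).
  - by lia.
  - by apply: St; lia.
  apply: (Gam_point gT (Gam_iter_tmul k Gz (etaT _ ec))).
    rewrite yE; elim: (k) => [|l IHl] //=.
    by rewrite coord_tmul cE IHl /=; congr Some; lia.
  (* Adding [c] cannot decrease coordinate [i], which stays above [a]. *)
  elim: (k) => [|l IHl] //=; rewrite coord_tmul.
  by case: (coord i c) (coord i (iter _ _ _)) IHl => [?|] [?|] //=; lia.
have [||r Tr [r_eq r_gt]] := @good_climb T gT i _ q Ty Tq.
- by rewrite coordN_pair_at qy.
- by rewrite coord_pair_at.
rewrite coord_pair_at in r_eq; rewrite coordN_pair_at in r_gt.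
have : A (coord (~~ i) r) by rewrite /A /= -(pair_at_eq r_eq erefl).
by move/ymax; lia.
Qed.

Lemma red_step_Gam eta : eta `<=` Gam T ->
    (forall i, exists2 c, eta c & coord i c = Some (coord i (multiplicity S))) ->
  red_step S eta `<=` Gam T.
Proof.
move=> etaT eta_e x [_ [/etaT //|[[[[[Gx _] _] abs_x] _] [red_x|red_x]]]].
  exact: reducible_fin_Gam red_x.
exact: reducible_inf_Gam red_x.
Qed.

End Minimality.

(** * Iterating the reduction *)

Lemma IA_Gam S : IA S `<=` Gam S.
Proof. by move=> x [[[]]]. Qed.

Lemma iter_red_step_IA S eta n : eta `<=` IA S -> iter n (red_step S) eta `<=` IA S.
Proof. by case: n => // n _ x []. Qed.

Lemma iter_red_step_multiplicity S eta n i : good_semigroup S -> eta `<=` IA S ->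
    (exists2 c, iter n (red_step S) eta c &
       coord i c = Some (coord i (multiplicity S))) ->
  exists2 c, eta c & coord i c = Some (coord i (multiplicity S)).
Proof.
move=> gS etaI; elim: n => // n IHn [c red_c cE]; apply: IHn.
apply: red_step_multiplicity red_c cE => //.
by apply: subset_trans (@IA_Gam S); apply: iter_red_step_IA.
Qed.

Theorem theorem31 (S : set (nat * nat)) (eta : set ext2)
  (hS : good_semigroup S) (heta : eta `<=` IA S) (hred : red S eta = IA S) :
  system_of_representatives S eta.
Proof.
have etaS : eta `<=` Gam S := subset_trans heta (@IA_Gam S).
split=> //; split=> // T gT etaT TS.
have eta_e i : exists2 c, eta c & coord i c = Some (coord i (multiplicity S)).
  have [c IAc cE] := IA_multiplicity hS i; rewrite -hred in IAc.
  by apply: (iter_red_step_multiplicity hS heta); exists c; first exact: IAc.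
(* That each iterate keeps [eta] is part of the induction, so that the shifting vectors remain
   available for [red_step_Gam]. *)
have iterT n : eta `<=` iter n (red_step S) eta /\ iter n (red_step S) eta `<=` Gam T.
  elim: n => [|n [eta_n nT]]; first by split.
  split=> /= [x ex|].
    by split; [exact: heta|left; exact: eta_n].
  apply: red_step_Gam => // i; have [c ec cE] := eta_e i.
  by exists c => //; exact: eta_n.
have IAT : IA S `<=` Gam T by rewrite -hred; apply: (iterT _).2.
apply/seteqP; split=> // p Sp; apply/Gam_fin.
by apply: (IA_generates hS (subsemiring_Gam gT) IAT); apply/Gam_fin.
Qed.
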